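(* Let $A$ be an $N$-homogeneous algebra admitting a side-confluent presentation $\langle X\mid R\rangle$ with $X$ finite. Then for all integers $n\geq 0$ and $m\geq l_N(n)$, the reduction pair $P_{n,m}=(F_1^{n,m},F_2^{n,m})$ of bi-degree $(n,m)$ associated with $\langle X\mid R\rangle$ is confluent, i.e. there is an integer $k$ with $\langle F_1^{n,m},F_2^{n,m}\rangle^k=\langle F_2^{n,m},F_1^{n,m}\rangle^k$.
   Context: $\mathbb{K}$ is a field, $N\geq 2$. For a set $X$, $X^{(m)}$ is the set of words of length $m$, $V=\mathbb{K}X$, $V^{\otimes m}=\mathbb{K}X^{(m)}$, $T(V)$ the tensor (free) algebra. An $N$-homogeneous presentation $\langle X\mid R\rangle$ of $A$: $R\subset V^{\otimes N}$, $A\cong T(V)/I(R)$; $\overline R=\mathrm{span}(R)$, $I(R)_m=0$ for $m<N$, $I(R)_m=\sum_{i=0}^{m-N}V^{\otimes i}\otimes\overline R\otimes V^{\otimes m-N-i}$ for $m\geq N$. $X$ is totally ordered, $X^{(m)}$ ordered lexicographically, $\mathrm{lm}(f)$ the greatest word occurring in $f\neq0$. Conventions: elements of $R$ have leading coefficient $1$; a word is a normal form if it has no factor $\mathrm{lm}(f)$, $f\in R$; the presentation is reduced (for each $f\in R$, $\mathrm{lm}(f)-f$ is a linear combination of normal-form words and $\mathrm{lm}(f)$ has no factor $\mathrm{lm}(g)$, $g\in R\setminus\{f\}$). The operator $S\in\mathrm{End}(V^{\otimes N})$: $S(\mathrm{lm}(f))=\mathrm{lm}(f)-f$ for $f\in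 R$, $S(w)=w$ otherwise. $\langle t,s\rangle^k$ denotes $\cdots sts$ with $k$ factors. Side-confluent: for each $1\leq m\leq N-1$ some $k$ satisfies $\langle\mathrm{id}_{V^{\otimes m}}\otimes S,S\otimes\mathrm{id}_{V^{\otimes m}}\rangle^k=\langle S\otimes\mathrm{id}_{V^{\otimes m}},\mathrm{id}_{V^{\otimes m}}\otimes S\rangle^k$. $l_N(2k)=kN$, $l_N(2k+1)=kN+1$; $J_0=\mathbb{K}$, $J_1=V$, $J_2=\overline R$, $J_n=\bigcap_{i=0}^{l_N(n)-N}V^{\otimes i}\otimes\overline R\otimes V^{\otimes l_N(n)-N-i}$ for $n\geq3$. For a finite totally ordered set $Y$, a reduction operator relatively to $Y$ is a linear projector $T$ of $\mathbb{K}Y$ such that for each $y\in Y$ either $T(y)=y$ or $T(y)$ is a combination of elements strictly smaller than $y$ (possibly $0$). For every subspace $W$ of $\mathbb{K}Y$ there is a unique such $T$ with $\ker T=W$, denoted $\theta_Y^{-1}(W)$. Reduction pair of bi-degree $(n,m)$, $m\geq l_N(n)$: $F_1^{n,m}=\theta_{X^{(m)}}^{-1}(I(R)_{m-l_N(n)}\otimes V^{\otimes l_N(n)})$; $F_2^{n,m}=\mathrm{id}_{V^{\otimes m}}$ if $m<l_N(n+1)$ and $F_2^{n,m}=\theta_{X^{(m)}}^{-1}(V^{\otimes m-l_N(n+1)}\otimes J_{n+1})$ otherwise. *)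

(* Defs.v *)
From mathcomp Require Import all_boot all_order all_algebra.
Unset Printing Implicit Defensive.
Import Order.TTheory GRing.Theory.
Local Open Scope ring_scope.

Definition lN (N n : nat) : nat :=
  if odd n then (n./2 * N + 1)%N else (n./2 * N)%N.

Section Presentation.
Variables (K : fieldType) (disp : Order.disp_t) (X : finOrderType disp).

(* X^(m) : words of length m; V^{(x)m} = K X^(m) : vectors with a coefficient
   for every word of length m *)
Definition word (m : nat) := (m.-tuple X)%type.
Definition vec (m : nat) := {ffun word m -> K^o}.

Definition ev {m : nat} (x : vec m) (s : seq X) : K :=
  match (insub s : option (word m)) with Some t => x t | None => 0 end.

Definition e (m : nat) (s : seq X) : vec m := [ffun t : word m => ((val t == s)%:R : K)].

(* tensor product x (x) y in V^{(x)a} (x) V^{(x)b} = V^{(x)m}, m = a + b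
   (concatenation of words) *)
Definition tens (m : nat) {a b : nat} (x : vec a) (y : vec b) : vec m :=
  [ffun t : word m => ev x (take a (val t)) * ev y (drop a (val t))].

(* linear endomorphisms of V^{(x)m}, given by the images of the basis words *)
Definition app {m : nat} (T : word m -> vec m) (x : vec m) : vec m :=
  \sum_(w : word m) x w *: T w.

Definition idop (m : nat) : word m -> vec m := fun w => e m (val w).

Definition idl (a n m : nat) (T : word n -> vec n) : word m -> vec m :=
  fun w => tens m (e a (take a (val w))) (app T (e n (drop a (val w)))).
Definition idr (n a m : nat) (T : word n -> vec n) : word m -> vec m :=
  fun w => tens m (app T (e n (take n (val w)))) (e a (drop n (val w))).

(* <t,s>^k = ... s t s  (k factors, rightmost factor s) *)
Fixpoint braid {m : nat} (t s : vec m -> vec m) (k : nat) : vec m -> vec m :=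
  match k with
  | 0 => id
  | k'.+1 => fun x => braid s t k' (s x)
  end.

Fixpoint lexlt (s t : seq X) : bool :=
  match s, t with
  | x :: s', y :: t' => (x < y)%O || ((x == y) && lexlt s' t')
  | _, _ => false
  end.

Definition is_lm {m : nat} (f : vec m) (w : word m) : bool :=
  (f w != 0) && [forall w' : word m, (f w' != 0) ==> ((w' == w) || lexlt (val w') (val w))].

Section Relations.
Variables (N : nat) (R : seq (vec N)).

Definition normal_form (s : seq X) : Prop :=
  forall f w, f \in R -> is_lm f w -> ~~ infix (val w) s.

Definition reduced_presentation : Prop :=
  (forall f, f \in R -> exists w, is_lm f w /\ f w = 1) /\
  (forall f w, f \in R -> is_lm f w ->
     forall w' : word N, w' != w -> f w' != 0 -> normal_form (val w')) /\
  (forall f g w w', f \in R -> g \in R -> g != f -> is_lm f w -> is_lm g w' ->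
     ~~ infix (val w') (val w)).

Definition Sop : word N -> vec N := fun w =>
  match [seq f <- R | is_lm f w] with
  | f :: _ => e N (val w) - f
  | [::] => e N (val w)
  end.

Definition side_confluent : Prop :=
  forall m, (1 <= m <= N - 1)%N ->
    exists k, (0 < k)%N /\
      braid (app (idl m N (m + N)%N Sop)) (app (idr N m (m + N)%N Sop)) k
      =1 braid (app (idr N m (m + N)%N Sop)) (app (idl m N (m + N)%N Sop)) k.

Definition in_span {m : nat} (G : vec m -> Prop) (x : vec m) : Prop :=
  exists s : seq (K * vec m), (forall p, p \in s -> G p.2) /\
    x = \sum_(p <- s) p.1 *: p.2.

Definition fullS (m : nat) : vec m -> Prop := fun _ => True.
Definition zeroS (m : nat) : vec m -> Prop := fun x => x = 0.

Definition tensS (m a b : nat) (P : vec a -> Prop) (Q : vec b -> Prop) : vec m -> Prop :=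
  in_span (fun g => exists x y, P x /\ Q y /\ g = tens m x y).

Definition Rbar : vec N -> Prop := in_span (fun g => g \in R).

Definition RbarAt (L i : nat) : vec L -> Prop :=
  tensS L (i + N) (L - N - i) (tensS (i + N) i N (@fullS i) Rbar) (@fullS (L - N - i)).

Definition IR (m : nat) : vec m -> Prop :=
  if (m < N)%N then @zeroS m
  else in_span (fun g => exists i, (i <= m - N)%N /\ RbarAt m i g).

(* J_n, as a subspace of V^{(x)L} with L = l_N(n) *)
Definition J (n L : nat) : vec L -> Prop :=
  match n with
  | 0 | 1 => @fullS L
  | 2 => fun x => exists y : vec N, Rbar y /\ forall s, ev x s = ev y s
  | _ => fun x => forall i, (i <= L - N)%N -> RbarAt L i x
  end.

End Relations.

Definition is_redop {m : nat} (T : word m -> vec m) : Prop :=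
  (forall w, app T (T w) = T w) /\
  (forall y : word m, T y = e m (val y) \/
     forall w : word m, T y w != 0 -> lexlt (val w) (val y)).

Definition ker_is {m : nat} (T : word m -> vec m) (W : vec m -> Prop) : Prop :=
  forall x, app T x = 0 <-> W x.

End Presentation.

Arguments word {disp} X m.
Arguments vec K {disp} X m.
Arguments reduced_presentation {K disp X N} R.
Arguments side_confluent {K disp X N} R.
Arguments IR {K disp X N} R m _.
Arguments J {K disp X N} R n L _.
Arguments tensS {K disp X} m a b P Q _.
Arguments fullS K {disp} X m _.
Arguments idop {K disp X} m _.
Arguments app {K disp X m} T x.
Arguments braid {K disp X m} t s k _.
Arguments is_redop {K disp X m} T.
Arguments ker_is {K disp X m} T W.

(* Main.v *)
Require Import Defs.
From mathcomp Require Import all_boot all_order all_algebra zify.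
Import Order.TTheory GRing.Theory.

(* Reduction operators with kernels P and Q form a confluent pair iff every
   leading word of P + Q is a leading word of P or of Q.  Let E_i be the subspace
   V^i (x) Rbar (x) V^(m-N-i) of V^m.  Any two E_i, E_j are confluent: by
   side-confluence when the two occurrences of Rbar overlap, and by contracting
   the first one against a coordinate of S otherwise.  The leading words of an
   intersection of two confluent subspaces are the common leading words, whence
   E_i is confluent with every intersection of E_j's; a diamond-lemma argument
   extends this to sums of E_i's.  The kernels of F_1 and F_2 are such a sum and
   such an intersection. *)

(** Side-confluence is an identity between [id (x) S] and [S (x) id], whereas [F1] and [F2] are
    known only through their kernels. The relation [conf] mentions subspaces alone, hence carries
    information from one kind of operator to the other: [conf_of_braid] goes from an identity to
    [conf], [braid_of_conf] goes back. The obstacle is the sum: confluence of P with Q1 and with Q2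
    does not give confluence of P with Q1 + Q2. For words a < b < c, take P, Q1, Q2 spanned by b +
    a, c, c + b: then a lies in P + Q1 + Q2, but is a leading word of neither P nor Q1 + Q2. Here Q1
    and Q2 are not confluent; this is why all pairs E_i, E_j are treated, also those on the same
    side of the reduction pair. Fixing the letters outside a window respects both membership in E_i
    and lexicographic comparison, so an overlapping pair is settled in the window that its two
    occurrences cover. *)

Section Subspaces.
Local Open Scope ring_scope.
Set Implicit Arguments.
Unset Strict Implicit.

Variables (K : fieldType) (U : lmodType K).
Implicit Types P Q : U -> Prop.

(** Subspaces are [Prop]-valued predicates because [tensS], [IR], [J] and [ker_is] are; everything
    below works with elements and leading words, without bases or dimensions. *)
Definition subspace P := P 0 /\ forall a x y, P x -> P y -> P (a *: x + y).

Lemma subspaceD P x y : subspace P -> P x -> P y -> P (x + y).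
Proof. by move=> [_ sP] Px Py; rewrite -[x]scale1r; apply: sP. Qed.

Lemma subspaceZ P a x : subspace P -> P x -> P (a *: x).
Proof. by move=> [P0 sP] Px; rewrite -[_ *: _]addr0; apply: sP. Qed.

Lemma subspaceB P x y : subspace P -> P x -> P y -> P (x - y).
Proof. by move=> sP Px Py; rewrite -scaleN1r; apply: subspaceD => //; apply: subspaceZ. Qed.

Lemma subspace_sum P I (r : seq I) (A : pred I) F :
  subspace P -> (forall i, A i -> P (F i)) -> P (\sum_(i <- r | A i) F i).
Proof.
move=> sP PF; elim/big_ind: _ => // [|x y]; first by case: sP.
exact: subspaceD.
Qed.

Definition sumP P Q x := exists y z, [/\ P y, Q z & x = y + z].

Lemma subspace_sumP P Q : subspace P -> subspace Q -> subspace (sumP P Q).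
Proof.
move=> sP sQ; split; first by exists 0, 0; rewrite addr0; split; [case: sP|case: sQ|].
move=> a _ _ [y [z [Py Qz ->]]] [y' [z' [Py' Qz' ->]]].
exists (a *: y + y'), (a *: z + z'); split; [exact: (proj2 sP)|exact: (proj2 sQ)|].
by rewrite scalerDr addrACA.
Qed.

Lemma subspace_sumPl P Q x : subspace Q -> P x -> sumP P Q x.
Proof. by move=> [Q0 _] Px; exists x, 0; rewrite addr0. Qed.

Lemma subspace_sumPr P Q x : subspace P -> Q x -> sumP P Q x.
Proof. by move=> [P0 _] Qx; exists 0, x; rewrite add0r. Qed.

Definition capE (I : eqType) (E : I -> U -> Prop) (s : seq I) x := forall i, i \in s -> E i x.

Lemma subspace_capE (I : eqType) (E : I -> U -> Prop) s :
  (forall i, i \in s -> subspace (E i)) -> subspace (capE E s).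
Proof.
move=> sE; split=> [i /sE[]//|a x y Ex Ey i si].
by case: (sE i si) => _; apply; [apply: Ex|apply: Ey].
Qed.

Definition sumE I (E : I -> U -> Prop) (s : seq I) : U -> Prop :=
  foldr (fun i => sumP (E i)) (fun x => x = 0) s.

Lemma subspace0 : subspace (fun x : U => x = 0).
Proof. by split=> // a x y -> ->; rewrite scaler0 addr0. Qed.

Lemma subspace_sumE (I : eqType) (E : I -> U -> Prop) s :
  (forall i, i \in s -> subspace (E i)) -> subspace (sumE E s).
Proof.
elim: s => [_|i s IHs sE]; first exact: subspace0.
apply: subspace_sumP; first by apply: sE; rewrite mem_head.
by apply: IHs => j sj; apply: sE; rewrite inE sj orbT.
Qed.

Lemma sub_sumE (I : eqType) (E : I -> U -> Prop) s i x :
  (forall i, i \in s -> subspace (E i)) -> i \in s -> E i x -> sumE E s x.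
Proof.
elim: s => // j s IHs sE; have sEs k : k \in s -> subspace (E k).
  by move=> sk; apply: sE; rewrite inE sk orbT.
rewrite inE => /predU1P[-> Ex|si Ex].
  by apply: subspace_sumPl Ex; apply: subspace_sumE.
by apply: subspace_sumPr; [apply: sE; rewrite mem_head|apply: IHs].
Qed.

Lemma sumE_sub (I : eqType) (E : I -> U -> Prop) s P x :
  subspace P -> (forall i y, i \in s -> E i y -> P y) -> sumE E s x -> P x.
Proof.
move=> sP; elim: s x => [|i s IHs] x sE /=; first by move->; case: sP.
case=> y [z [Ey Ez ->]]; apply: subspaceD => //.
  by apply: sE Ey; rewrite mem_head.
by apply: IHs Ez => j t sj; apply: sE; rewrite inE sj orbT.
Qed.

End Subspaces.

(** * Leading words of subspaces, and confluence of two subspaces *)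

Section LeadingTerms.
Local Open Scope ring_scope.
Set Implicit Arguments.
Unset Strict Implicit.

Variables (K : fieldType) (T : finType) (rk : T -> nat).
Hypothesis rk_inj : injective rk.
Local Notation V := {ffun T -> K^o}.
Implicit Types (P Q : V -> Prop) (f g : V) (w : T).

(** The order on words enters only through the injective rank [rk], so that reductions can be run by
    induction on a number bounding the support. *)
Definition below n f := forall w, f w != 0 -> (rk w < n)%N.
Definition lead f w := f w != 0 /\ below (rk w).+1 f.
Definition lms P w := exists2 f, P f & lead f w.

Lemma scaleD_coef (a : K) f g w : (a *: f + g) w = a * f w + g w.
Proof. by rewrite !ffunE. Qed.

Lemma scaleB_coef (a : K) f g w : (f - a *: g) w = f w - a * g w.
Proof. by rewrite !ffunE. Qed.

Lemma below0 n : below n 0.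
Proof. by move=> w; rewrite ffunE eqxx. Qed.

Lemma belowP n f w : below n f -> (n <= rk w)%N -> f w = 0.
Proof. by move=> bf; apply: contraTeq; rewrite -ltnNge; apply: bf. Qed.

Lemma below_subspace n : subspace (below n).
Proof.
split=> [|a x y bx by_ w]; first exact: below0.
rewrite scaleD_coef; apply: contraR; rewrite -leqNgt => lenw.
by rewrite (belowP bx) // (belowP by_) // mulr0 addr0.
Qed.

Lemma belowW m n f : (m <= n)%N -> below m f -> below n f.
Proof. by move=> lemn bf w /bf /leq_trans; apply. Qed.

Lemma below_lead n f w : below n f -> lead f w -> (rk w < n)%N.
Proof. by move=> bf [fw _]; apply: bf. Qed.

Lemma lead_neq0 f w : lead f w -> f <> 0.
Proof. by case=> fw _ f0; rewrite f0 ffunE eqxx in fw. Qed.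

Lemma below_eq0 f : below 0 f -> f = 0.
Proof. by move=> bf; apply/ffunP => w; rewrite ffunE (belowP bf). Qed.

Lemma lead_exists f : f != 0 -> exists w, lead f w.
Proof.
move=> nzf; have [w0 fw0] : exists w, f w != 0.
  apply/existsP; apply: contraR nzf => /existsPn f0.
  by apply/eqP/ffunP => w; rewrite ffunE; apply/eqP; rewrite -[_ == _]negbK f0.
exists [arg max_(w > w0 | f w != 0) rk w].
by case: arg_maxnP => // w fw maxw; split=> // w' /maxw; rewrite ltnS.
Qed.

Lemma lead_uniq f w w' : lead f w -> lead f w' -> w = w'.
Proof.
case=> fw bw [fw' bw']; apply: rk_inj; apply/eqP; rewrite eqn_leq.
by rewrite -![(rk _ <= _)%N]ltnS bw // bw'.
Qed.

Lemma below_cancel n f w : below n.+1 f -> rk w = n -> f w = 0 -> below n f.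
Proof.
move=> bf rw fw w' fw'; have:= bf _ fw'; rewrite ltnS leq_eqVlt => /predU1P[|//].
by rewrite -rw => /rk_inj eqw; rewrite eqw fw eqxx in fw'.
Qed.

Lemma lead_cancel f g w : lead f w -> lead g w -> below (rk w) (f - (f w / g w) *: g).
Proof.
move=> [fw bf] [gw bg]; apply: (@below_cancel _ _ w) => //.
  by apply: (subspaceB (@below_subspace _)) => //; apply: (subspaceZ _ (@below_subspace _)).
by rewrite scaleB_coef divfK // subrr.
Qed.

(** For subspaces the converse inclusion is automatic: leading words of [P] or [Q] are leading words
    of the sum. *)
Definition conf P Q := forall f g w, P f -> Q g -> lead (f + g) w -> lms P w \/ lms Q w.

Lemma conf_sym P Q : conf P Q -> conf Q P.
Proof.
move=> cPQ f g w Qf Pg; rewrite addrC => /(cPQ _ _ _ Pg Qf)[]; by [right|left].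
Qed.

Lemma conf_refl P : subspace P -> conf P P.
Proof. by move=> sP f g w Pf Pg ld; left; exists (f + g) => //; apply: subspaceD. Qed.

Lemma conf_ext P P' Q Q' : (forall f, P f <-> P' f) -> (forall f, Q f <-> Q' f) ->
  conf P Q -> conf P' Q'.
Proof.
move=> eP eQ cPQ f g w /eP Pf /eQ Qg /(cPQ _ _ _ Pf Qg).
by case=> [] [h] ? ?; [left|right]; exists h => //; [apply/eP|apply/eQ].
Qed.

Lemma conf_full P Q : (forall f, Q f) -> conf P Q.
Proof. by move=> QT f g w Pf Qg ld; right; exists (f + g). Qed.

Lemma conf_zero P : conf P (fun f => f = 0).
Proof. by move=> f g w Pf ->; rewrite addr0 => ld; left; exists f. Qed.

(** Existence of standard representations: large terms that cancel between [f] and [g] can be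
    avoided. The leading word of [f + g] is also led by an element of [P] or of [Q]; subtracting a
    multiple of it lowers the sum, and the induction on the bound applies. *)
Lemma conf_standard P Q n f g : subspace P -> subspace Q -> conf P Q ->
  P f -> Q g -> below n (f + g) ->
  exists f' g', [/\ P f' /\ below n f', Q g' /\ below n g' & f' + g' = f + g].
Proof.
move=> sP sQ cPQ; elim/ltn_ind: n f g => n IHn f g Pf Qg bfg.
have [fg0|/lead_exists[w ld]] := eqVneq (f + g) 0.
  exists 0, 0; rewrite addr0 fg0; have b0 := @below0 n.
  by split=> //; split=> //; [case: sP|case: sQ].
have ltwn := below_lead bfg ld.
have [[p Pp lp]|[q Qq lq]] := cPQ _ _ _ Pf Qg ld.
  have := lead_cancel ld lp; set c := _ / _; rewrite addrAC =>
    /(IHn _ ltwn) [||f' [g' [[Pf' bf'] [Qg' bg'] e']]] //.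
    by apply: subspaceB => //; apply: subspaceZ.
  exists (f' + c *: p), g'; split; last by rewrite addrAC e' addrAC subrK.
    split; first by apply: subspaceD => //; apply: subspaceZ.
    apply: (subspaceD (@below_subspace _)).
      exact: belowW (ltnW ltwn) bf'.
    apply: (subspaceZ _ (@below_subspace _)).
    by apply: belowW (proj2 lp).
  by split=> //; apply: belowW (ltnW ltwn) bg'.
have := lead_cancel ld lq; set c := _ / _; rewrite -addrA =>
    /(IHn _ ltwn) [||f' [g' [[Pf' bf'] [Qg' bg'] e']]] //.
  by apply: subspaceB => //; apply: subspaceZ.
exists f', (g' + c *: q); split; last by rewrite addrA e' addrA subrK.
  by split=> //; apply: belowW (ltnW ltwn) bf'.
split; first by apply: subspaceD => //; apply: subspaceZ.
apply: (subspaceD (@below_subspace _)).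
  exact: belowW (ltnW ltwn) bg'.
apply: (subspaceZ _ (@below_subspace _)).
by apply: belowW (proj2 lq).
Qed.

(** Cancelling the leading terms leaves [f - c *: g] below [w], with a standard representation
    [f' + g']. Then [f - f'], which equals [g' + c *: g], lies in both subspaces, and the correction
    [f'] is too small to disturb the leading word [w]. *)
Lemma conf_lms_cap P Q w : subspace P -> subspace Q -> conf P Q ->
  lms P w -> lms Q w -> lms (fun f => P f /\ Q f) w.
Proof.
move=> sP sQ cPQ [f Pf lf] [g Qg lg].
set c := f w / g w.
have Qcg : Q (- (c *: g)) by rewrite -scaleNr; apply: subspaceZ.
have [f' [g' [[Pf' bf'] [Qg' bg'] e']]] :=
  conf_standard sP sQ cPQ Pf Qcg (lead_cancel lf lg).
exists (f - f'); first split.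
- exact: subspaceB.
- have -> : f - f' = g' + c *: g by apply/eqP; rewrite subr_eq addrC addrA e' subrK.
  by apply: subspaceD => //; apply: subspaceZ.
case: lf => fw bf; split.
  by rewrite !ffunE (belowP bf') // subr0.
apply: (subspaceB (@below_subspace _)) => //.
exact: belowW bf'.
Qed.

(* No distributivity is needed: Q1 `&` Q2 + P lies in both P + Q1 and P + Q2. *)
Lemma conf_cap P Q1 Q2 : subspace Q1 -> subspace Q2 ->
  conf P Q1 -> conf P Q2 -> conf Q1 Q2 -> conf P (fun f => Q1 f /\ Q2 f).
Proof.
move=> s1 s2 c1 c2 c12 f g w Pf [Q1g Q2g] ld.
have [?|l1] := c1 _ _ _ Pf Q1g ld; first by left.
have [?|l2] := c2 _ _ _ Pf Q2g ld; first by left.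
by right; apply: conf_lms_cap.
Qed.

(** The elementary move of the diamond argument: the coefficient of [f] at [w] is passed on to [g].
    When [w] leads both, a common element [h] of [P] and [Q] led by [w] can be moved from one
    summand to the other. The last hypothesis rules out that [w] occurs in [f] only. *)
Lemma conf_cancel P Q n w f g : subspace P -> subspace Q -> conf P Q -> rk w = n ->
  P f -> Q g -> below n.+1 f -> below n.+1 g -> (g w = 0 -> f w = 0) ->
  exists f' g', [/\ P f' /\ below n f', Q g' /\ below n.+1 g' & f' + g' = f + g].
Proof.
move=> sP sQ cPQ rw Pf Qg bf bg gf.
have [fw|nzf] := eqVneq (f w) 0.
  by exists f, g; split=> //; split=> //; apply: below_cancel fw.
have nzg : g w != 0 by apply: contra_neq nzf.
have lf : lead f w by split; rewrite ?rw.
have lg : lead g w by split; rewrite ?rw.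
have [h [Ph Qh] lh] : lms (fun f => P f /\ Q f) w.
  by apply: conf_lms_cap => //; [exists f|exists g].
have := lead_cancel lf lh; set c := _ / _ => bfh.
exists (f - c *: h), (g + c *: h); split; last by rewrite addrACA addNr addr0.
  by split; [apply: subspaceB => //; apply: subspaceZ|rewrite -rw].
split; first by apply: subspaceD => //; apply: subspaceZ.
apply: (subspaceD (@below_subspace _)) => //.
apply: (subspaceZ _ (@below_subspace _)).
by rewrite -rw; case: lh.
Qed.

(** Induction on a common bound for the three summands. At the top word [t] either the sum has a
    nonzero coefficient, so [t] is [w] and some summand is led by it, or the three coefficients
    cancel; they are then removed pairwise, which lowers the bound without changing the sum. *)
Lemma conf_triple P1 P2 P3 f1 f2 f3 w :
  subspace P1 -> subspace P2 -> subspace P3 ->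
  conf P1 P2 -> conf P1 P3 -> conf P2 P3 ->
  P1 f1 -> P2 f2 -> P3 f3 -> lead (f1 + f2 + f3) w ->
  [\/ lms P1 w, lms P2 w | lms P3 w].
Proof.
move=> s1 s2 s3 c12 c13 c23 P1f P2f P3f.
have [n [b1 b2 b3]] : exists n, [/\ below n f1, below n f2 & below n f3].
  by exists (\max_t rk t).+1; split=> t _; rewrite ltnS leq_bigmax.
elim: n => [|n IHn] in f1 f2 f3 P1f P2f P3f b1 b2 b3 *.
  by rewrite (below_eq0 b1) (below_eq0 b2) (below_eq0 b3) !addr0 => -[]; rewrite ffunE eqxx.
move=> ld; have sb := below_subspace.
have bs : below n.+1 (f1 + f2 + f3) by do 2!apply: (subspaceD (sb _)) => //.
(* Ranks need not be consecutive; if no word has rank [n], the bound drops by itself. *)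
have [t /eqP rt|no_t] := pickP (fun t => rk t == n); last first.
  have bn f : below n.+1 f -> below n f.
    by move=> bf t /bf; rewrite ltnS leq_eqVlt no_t.
  by apply: IHn ld => //; apply: bn.
have [s0|nz] := eqVneq ((f1 + f2 + f3) t) 0; last first.
  have <- : t = w by apply: lead_uniq ld; split; rewrite ?rt.
  have [z1|n1] := eqVneq (f1 t) 0; last by constructor 1; exists f1 => //; split; rewrite ?rt.
  have [z2|n2] := eqVneq (f2 t) 0; last by constructor 2; exists f2 => //; split; rewrite ?rt.
  constructor 3; exists f3 => //; split; rewrite ?rt //.
  by apply: contra_neq nz; rewrite !ffunE z1 z2 => ->; rewrite !addr0.
(* With nothing at [t] in [f2], the coefficients of [f1] and [f3] are opposite and cancel directly.
   Otherwise the coefficient of [f1] goes to [f2], then that of the new second summand to [f3]. *)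
have [z2|n2] := eqVneq (f2 t) 0.
  have z13 : f3 t = 0 -> f1 t = 0 by move=> z3; rewrite !ffunE z2 z3 !addr0 in s0.
  have [g1 [g3 [[P1g bg1] [P3g bg3] e13]]] := conf_cancel s1 s3 c13 rt P1f P3f b1 b3 z13.
  have e : g1 + f2 + g3 = f1 + f2 + f3 by rewrite addrAC e13 addrAC.
  have bg3' : below n g3.
    apply: (below_cancel _ rt) => //; move: s0; rewrite -e !ffunE z2 addr0.
    by rewrite (belowP bg1) ?rt // add0r.
  by apply: (IHn g1 f2 g3); rewrite ?e //; apply: below_cancel z2.
have z12 : f2 t = 0 -> f1 t = 0 by move=> z2; rewrite z2 eqxx in n2.
have [g1 [g2 [[P1g bg1] [P2g bg2] e12]]] := conf_cancel s1 s2 c12 rt P1f P2f b1 b2 z12.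
have z23 : f3 t = 0 -> g2 t = 0.
  move=> z3; move: s0; rewrite -e12 !ffunE z3 addr0.
  by rewrite (belowP bg1) ?rt // add0r.
have [h2 [h3 [[P2h bh2] [P3h bh3] e23]]] := conf_cancel s2 s3 c23 rt P2g P3f bg2 b3 z23.
have e : g1 + h2 + h3 = f1 + f2 + f3 by rewrite -addrA e23 addrA e12.
apply: (IHn g1 h2 h3); rewrite ?e //.
(* The third summand now carries the whole coefficient of the sum at [t], which is zero. *)
apply: (below_cancel _ rt) => //; move: s0; rewrite -e !ffunE.
by rewrite (belowP bg1) ?rt // (belowP bh2) ?rt // !add0r.
Qed.

Lemma conf_sumP P1 P2 Q : subspace P1 -> subspace P2 -> subspace Q ->
  conf P1 P2 -> conf P1 Q -> conf P2 Q -> conf (sumP P1 P2) Q.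
Proof.
move=> s1 s2 sQ c12 c1 c2 _ g w [f1 [f2 [P1f P2f ->]]] Qg ld.
have [] := conf_triple s1 s2 sQ c12 c1 c2 P1f P2f Qg ld; last by right.
  by case=> h Ph lh; left; exists h => //; apply: subspace_sumPl.
by case=> h Ph lh; left; exists h => //; apply: subspace_sumPr.
Qed.

(** * Sums and intersections in a family of pairwise confluent subspaces *)

Section Families.
Variables (I : eqType) (E : I -> V -> Prop) (D : {pred I}).
Hypothesis sE : forall i, i \in D -> subspace (E i).
Hypothesis cE : forall i j, i \in D -> j \in D -> conf (E i) (E j).

(** The induction keeps [i] general: [conf_cap] also asks that the head of [s] be confluent with the
    intersection of the tail, which is the induction hypothesis at the head. *)
Lemma conf_capE i s : i \in D -> {subset s <= D} -> conf (E i) (capE E s).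
Proof.
elim: s i => [|j s IHs] i Di sD; first by apply: conf_full => f k.
have Dj : j \in D by apply: sD; rewrite mem_head.
have {}sD : {subset s <= D} by move=> k sk; apply: sD; rewrite inE sk orbT.
apply: (@conf_ext (E i) _ (fun f => E j f /\ capE E s f)) => // [f|].
  split=> [[Ej Es] k|Es]; first by rewrite inE => /predU1P[->|/Es].
  by split=> [|k sk]; apply: Es; rewrite inE ?eqxx ?sk ?orbT.
apply: conf_cap; [exact: sE| |exact: cE|exact: IHs|exact: IHs].
by apply: subspace_capE => k /sD /sE.
Qed.

(** [Q] stays general because the induction hypothesis serves twice: for [Q], and with the head
    [E i] in place of [Q], as [conf_sumP] needs the head confluent with the rest of the sum. *)
Lemma conf_sumE Q s : subspace Q -> {subset s <= D} ->
  (forall i, i \in D -> conf (E i) Q) -> conf (sumE E s) Q.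
Proof.
move=> sQ sD; elim: s Q sQ sD => [|i s IHs] Q sQ sD cQ.
  exact/conf_sym/conf_zero.
have Di : i \in D by apply: sD; rewrite mem_head.
have {}sD : {subset s <= D} by move=> k sk; apply: sD; rewrite inE sk orbT.
apply: conf_sumP => //; [exact: sE| | |exact: cQ|exact: IHs].
  by apply: subspace_sumE => k /sD /sE.
by apply/conf_sym/IHs => //; [exact: sE|move=> k Dk; exact: cE].
Qed.

Lemma conf_sumE_capE r s :
  {subset r <= D} -> {subset s <= D} -> conf (sumE E r) (capE E s).
Proof.
move=> rD sD; apply: conf_sumE => // [|i Di]; last exact: conf_capE.
by apply: subspace_capE => k /sD /sE.
Qed.

End Families.

End LeadingTerms.

(** * Operators on words of fixed length; confluence of operators against confluence of kernels *)

Section Words.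
Local Open Scope ring_scope.
Set Implicit Arguments.
Unset Strict Implicit.

Variables (K : fieldType) (disp : Order.disp_t) (X : finOrderType disp).
Local Notation lexlt := (@lexlt disp X).
Local Notation e := (e K disp X).
Implicit Types (s t u v : seq X).

Lemma lexlt_irr s : lexlt s s = false.
Proof. by elim: s => //= x s IHs; rewrite ltxx IHs andbF. Qed.

Lemma lexlt_trans : transitive lexlt.
Proof.
elim=> [|y t IHt] [|x s] [|z u] //= /orP[xy|/andP[/eqP-> st]] /orP[yz|/andP[/eqP<- tu]].
- by rewrite (lt_trans xy yz).
- by rewrite xy.
- by rewrite yz.
- by rewrite eqxx (IHt _ _ st tu) orbT.
Qed.

Lemma lexlt_total s t : size s = size t -> s != t -> lexlt s t || lexlt t s.
Proof.
elim: s t => [|x s IHs] [|y t] //= [est]; rewrite eqseq_cons negb_and.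
case: (ltgtP x y) => //= _.
exact: IHs.
Qed.

Lemma lexlt_cat s1 s2 t1 t2 : size s1 = size s2 ->
  lexlt (s1 ++ t1) (s2 ++ t2) = lexlt s1 s2 || (s1 == s2) && lexlt t1 t2.
Proof.
elim: s1 s2 => [|x s IHs] [|y t] //= [est]; rewrite IHs // eqseq_cons.
by case: ltgtP => //=.
Qed.

Section Length.
Variable m : nat.
Implicit Types (w : word X m) (x y : vec K X m) (T : word X m -> vec K X m).

Definition rkw w := #|[set w' : word X m | lexlt (val w') (val w)]|.

Lemma lexlt_rkw w w' : lexlt (val w) (val w') -> (rkw w < rkw w')%N.
Proof.
move=> ltw; apply: proper_card; apply/properP; split.
  by apply/subsetP => t; rewrite !inE => /lexlt_trans; apply.
by exists w; rewrite !inE ?lexlt_irr.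
Qed.

Lemma rkw_lexlt w w' : (rkw w < rkw w')%N = lexlt (val w) (val w').
Proof.
apply/idP/idP => [lt|]; last exact: lexlt_rkw.
have nw : val w != val w' by apply: contraTneq lt => /val_inj->; rewrite ltnn.
have := @lexlt_total (val w) (val w'); rewrite !size_tuple => /(_ erefl nw).
case/orP => // /lexlt_rkw gt.
by have := ltn_trans lt gt; rewrite ltnn.
Qed.

Lemma rkw_inj : injective rkw.
Proof.
move=> w w' eqr; apply/val_inj/eqP; apply: contraT => nw.
have := @lexlt_total (val w) (val w'); rewrite !size_tuple => /(_ erefl nw).
by rewrite -!rkw_lexlt eqr ltnn.
Qed.

Lemma e_coef w w' : e m (val w) w' = (w' == w)%:R.
Proof. by rewrite ffunE val_eqE. Qed.

Lemma app_coef T x w : app T x w = \sum_w' (x w' : K) * T w' w.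
Proof. by rewrite /app sum_ffunE; apply: eq_bigr => w' _; rewrite ffunE. Qed.

Lemma app_linear T a x y : app T (a *: x + y) = a *: app T x + app T y.
Proof.
apply/ffunP => w; rewrite scaleD_coef !app_coef mulr_sumr -big_split /=.
by apply: eq_bigr => w' _; rewrite scaleD_coef mulrDl mulrA.
Qed.

Lemma app_ker_subspace T : subspace (fun x => app T x = 0).
Proof.
split=> [|a x y Tx Ty]; last by rewrite app_linear Tx Ty scaler0 addr0.
by apply/ffunP => w; rewrite app_coef ffunE big1 // => t _; rewrite ffunE mul0r.
Qed.

Lemma app0 T : app T 0 = 0.
Proof. by case: (app_ker_subspace T). Qed.

Lemma appB T x y : app T (x - y) = app T x - app T y.
Proof. by rewrite addrC -scaleN1r app_linear scaleN1r addrC. Qed.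

Lemma app_e T w : app T (e m (val w)) = T w.
Proof.
apply/ffunP => w'; rewrite app_coef (bigD1 w) //= e_coef eqxx mul1r big1 ?addr0 //.
by move=> t /negPf nt; rewrite e_coef nt mul0r.
Qed.

(** The order condition of [is_redop] without idempotence, so that it applies to [id (x) S] and
    [S (x) id] with no check that these are projectors. *)
Definition triangular T := forall w, T w = e m (val w) \/ below rkw (rkw w) (T w).

(** Images of words smaller than [w] never reach [w], and the larger words occurring in [x] are
    fixed; only the term of [w] itself contributes. *)
Lemma triangular_coef T x w : triangular T ->
  (forall w', (rkw w < rkw w')%N -> x w' != 0 -> T w' = e m (val w')) ->
  app T x w = if T w == e m (val w) then x w else 0.
Proof.
move=> trT fixT; rewrite app_coef (bigD1 w) //= big1 ?addr0 => [|w' nw].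
  case: eqP => [->|nT]; first by rewrite e_coef eqxx mulr1.
  by case: (trT w) => // /belowP->; rewrite ?mulr0.
have [->|nx] := eqVneq (x w') 0; first by rewrite mul0r.
case: (ltngtP (rkw w) (rkw w')) => [/fixT->//|lt|/rkw_inj ew]; last by rewrite ew eqxx in nw.
  by rewrite e_coef eq_sym (negPf nw) mulr0.
case: (trT w') => [->|/belowP->]; rewrite ?mulr0 ?(ltnW lt) //.
by rewrite e_coef eq_sym (negPf nw) mulr0.
Qed.

Lemma triangular_lead T x w : triangular T -> T w = e m (val w) ->
  lead rkw x w -> lead rkw (app T x) w.
Proof.
move=> trT fixw [nx bx].
have above w' : (rkw w < rkw w')%N -> x w' = 0 by move=> lt; rewrite (belowP bx).
split.
  by rewrite triangular_coef ?fixw ?eqxx // => w' /above->; rewrite eqxx.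
move=> w'; apply: contraR; rewrite -leqNgt => lt.
rewrite triangular_coef //; first by rewrite above // if_same.
by move=> t ltt; rewrite above ?eqxx // (ltn_trans lt).
Qed.

Lemma braid0 A B k : braid (app A) (app B) k 0 = 0 :> vec K X m.
Proof. by elim: k A B => //= k IHk A B; rewrite app0. Qed.

Lemma braid_subspace (P : vec K X m -> Prop) A B k : subspace P ->
  (forall x, P (x - app A x)) -> (forall x, P (x - app B x)) ->
  forall x, P (x - braid (app A) (app B) k x).
Proof.
move=> sP; elim: k A B => [|k IHk] A B PA PB x /=.
  by rewrite subrr; case: sP.
rewrite -(subrK (app B x) x) -addrA; apply: subspaceD => //.
by rewrite subrK; apply: IHk.
Qed.

Lemma braid_linear A B k a x y : braid (app A) (app B) k (a *: x + y) =
  a *: braid (app A) (app B) k x + braid (app A) (app B) k y.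
Proof. by elim: k A B x y => //= k IHk A B x y; rewrite app_linear IHk. Qed.

Lemma braid_lead A B k x w : triangular A -> triangular B ->
  A w = e m (val w) -> B w = e m (val w) ->
  lead rkw x w -> lead rkw (braid (app A) (app B) k x) w.
Proof.
elim: k A B x => //= k IHk A B x tA tB fA fB lx.
by apply: IHk => //; apply: triangular_lead.
Qed.

(** If [A] and [B] both fix the leading word [w] of [f + g], every alternating product keeps [w] as
    leading word. Yet the product ending with [B] on the right kills [g], and, being equal to the
    one ending with [A], kills [f] as well. A positive [k] ensures that such a rightmost factor
    exists. *)
Lemma conf_of_braid A B (P Q : vec K X m -> Prop) k :
  triangular A -> triangular B ->
  (forall x, P x -> app A x = 0) -> (forall x, Q x -> app B x = 0) ->
  (forall w, A w <> e m (val w) -> lms rkw P w) ->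
  (forall w, B w <> e m (val w) -> lms rkw Q w) ->
  (0 < k)%N -> braid (app A) (app B) k =1 braid (app B) (app A) k ->
  conf rkw P Q.
Proof.
move=> tA tB kP kQ lP lQ; case: k => [//|k] _ eqb f g w Pf Qg ld.
have [fA|/eqP] := eqVneq (A w) (e m (val w)); last by left; apply: lP.
have [fB|/eqP] := eqVneq (B w) (e m (val w)); last by right; apply: lQ.
case: (lead_neq0 (braid_lead k.+1 tA tB fA fB ld)).
rewrite -[f]scale1r braid_linear scale1r eqb /= (kP _ Pf) (kQ _ Qg).
by rewrite !braid0 addr0.
Qed.

Definition fixed_above A B n x := forall w, (n <= rkw w)%N -> x w != 0 ->
  A w = e m (val w) /\ B w = e m (val w).

Lemma fixed_above_app A B n x : triangular A ->
  fixed_above A B n x -> fixed_above A B n (app A x).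
Proof.
move=> tA fx w le; rewrite triangular_coef // => [|w' lt /fx[]//].
  by case: ifP => _; [apply: fx|rewrite eqxx].
exact: ltnW (leq_ltn_trans le lt).
Qed.

Lemma fixed_above_sym A B n x : fixed_above A B n x -> fixed_above B A n x.
Proof. by move=> fx w le /(fx w le)[]. Qed.

(** Each pair of factors gains one rank: a word of rank [n] surviving in [app A (app B x)] is fixed
    by [A], hence survived in [app B x], hence is fixed by [B]. *)
Lemma fixed_above_pred A B n x : triangular A -> triangular B ->
  fixed_above A B n.+1 x -> fixed_above A B n (app A (app B x)).
Proof.
move=> tA tB fx w le.
have fBx : fixed_above A B n.+1 (app B x).
  exact/fixed_above_sym/fixed_above_app/fixed_above_sym.
rewrite triangular_coef // => [|w' lt /fBx[]//]; last exact: leq_ltn_trans le lt.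
case: ifP => [/eqP fA|_]; last by rewrite eqxx.
rewrite triangular_coef // => [|w' lt /fx[]//]; last exact: leq_ltn_trans le lt.
by case: ifP => [/eqP|_]; last rewrite eqxx.
Qed.

Lemma braid_fixed_above A B n k x : triangular A -> triangular B ->
  fixed_above A B (n + k) x -> fixed_above A B n (braid (app A) (app B) k.*2 x).
Proof.
move=> tA tB; elim: k x => [|k IHk] x; first by rewrite addn0.
by rewrite addnS doubleS /= => /(fixed_above_pred tA tB)/IHk.
Qed.

Lemma redop_triangular T : is_redop T -> triangular T.
Proof.
case=> _ tT w; case: (tT w) => [->|bT]; [by left|right].
by move=> w' /bT; rewrite rkw_lexlt.
Qed.

Lemma redop_idem T x : is_redop T -> app T (app T x) = app T x.
Proof.
case=> idT _; have -> : app T x = \sum_w x w *: T w by [].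
have sum_lin (r : seq (word X m)) :
    app T (\sum_(w <- r) x w *: T w) = \sum_(w <- r) x w *: T w.
  elim: r => [|w r IHr]; first by rewrite !big_nil app0.
  by rewrite !big_cons app_linear IHr idT.
exact: sum_lin.
Qed.

Lemma lms_kernel T (P : vec K X m -> Prop) w : is_redop T -> ker_is T P ->
  lms rkw P w -> T w <> e m (val w).
Proof.
move=> rT kT [f Pf lf] fw.
case: (lead_neq0 (triangular_lead (redop_triangular rT) fw lf)).
exact/kT.
Qed.

(** Long alternating products are supported on words fixed by both operators. The difference of the
    two products lies in [P + Q], so by confluence its leading word would lead an element of one
    kernel; but an operator never fixes a leading word of its kernel. *)
Lemma braid_of_conf A B (P Q : vec K X m -> Prop) :
  is_redop A -> is_redop B -> ker_is A P -> ker_is B Q ->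
  subspace P -> subspace Q -> conf rkw P Q ->
  exists k, (0 < k)%N /\ braid (app A) (app B) k =1 braid (app B) (app A) k.
Proof.
move=> rA rB kA kB sP sQ cPQ; have tA := redop_triangular rA; have tB := redop_triangular rB.
(* [n] exceeds all ranks and each rank costs two factors. [fixed_above] at level [n] is vacuous,
   which starts the descent to level 0. *)
pose n := (\max_(w : word X m) rkw w).+1; exists n.*2; split; first by [].
have sPQ := subspace_sumP sP sQ.
have PA x : sumP P Q (x - app A x).
  by apply: subspace_sumPl => //; apply/kA; rewrite appB redop_idem // subrr.
have QB x : sumP P Q (x - app B x).
  by apply: subspace_sumPr => //; apply/kB; rewrite appB redop_idem // subrr.
have fx x : fixed_above A B (0 + n) x.
  by move=> w; rewrite leqNgt ltnS leq_bigmax.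
move=> x; apply/eqP; rewrite -subr_eq0; apply: contraT => /(lead_exists rkw)[w ld].
have fix_w : A w = e m (val w) /\ B w = e m (val w).
  have [y0|ny] := eqVneq (braid (app A) (app B) n.*2 x w) 0; last first.
    by apply: braid_fixed_above ny.
  have [z0|nz] := eqVneq (braid (app B) (app A) n.*2 x w) 0; last first.
    apply: (fixed_above_sym _ (leq0n _) nz); apply: braid_fixed_above => //.
    exact: fixed_above_sym.
  by case: ld; rewrite !ffunE y0 z0 subrr eqxx.
have [f [g [Pf Qg eqfg]]] : sumP P Q (braid (app A) (app B) n.*2 x - braid (app B) (app A) n.*2 x).
  have := subspaceB sPQ (braid_subspace n.*2 sPQ QB PA x) (braid_subspace n.*2 sPQ PA QB x).
  by rewrite opprB addrC addrA subrK.
rewrite eqfg in ld; case: (cPQ _ _ _ Pf Qg ld).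
  by move/(lms_kernel rA kA); case: fix_w.
by move/(lms_kernel rB kB); case: fix_w.
Qed.

End Length.
End Words.

(** * Tensor products in coordinates: cutting a window out of a vector and filling it back *)

Section Slices.
Local Open Scope ring_scope.
Set Implicit Arguments.
Unset Strict Implicit.

Variables (K : fieldType) (disp : Order.disp_t) (X : finOrderType disp).
Local Notation lexlt := (@lexlt disp X).
Local Notation e := (e K disp X).
Local Notation ev := (ev K disp X).
Local Notation tens m := (tens K disp X m).
Local Notation in_span := (in_span K disp X).
Local Notation lead := (lead (@rkw disp X _)).
Local Notation lms := (lms (@rkw disp X _)).
Local Notation conf := (conf (@rkw disp X _)).
Implicit Types (s t u v : seq X).

Lemma word_of m s : size s = m -> exists w : word X m, val w = s.
Proof. by move=> sz; exists (Tuple (introT eqP sz)). Qed.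

Lemma ev_val m (x : vec K X m) (w : word X m) : ev x (val w) = x w.
Proof. by rewrite /ev valK. Qed.

Lemma ev_out m (x : vec K X m) s : size s != m -> ev x s = 0.
Proof. by move=> sz; rewrite /ev insubN. Qed.

Lemma ev_size m (x : vec K X m) s : ev x s != 0 -> size s = m.
Proof. by move=> nz; apply/eqP; apply: contraR nz => /ev_out->. Qed.

Lemma vec_ext m (x y : vec K X m) :
  (forall s, size s = m -> ev x s = ev y s) -> x = y.
Proof. by move=> exy; apply/ffunP => w; rewrite -!ev_val exy ?size_tuple. Qed.

Lemma ev_linear m a (x y : vec K X m) s : ev (a *: x + y) s = a * ev x s + ev y s.
Proof.
have [/word_of[w <-]|sz] := eqVneq (size s) m; first by rewrite !ev_val scaleD_coef.
by rewrite !ev_out ?mulr0 ?addr0.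
Qed.

Lemma ev0 m s : ev (0 : vec K X m) s = 0.
Proof.
have [/word_of[w <-]|sz] := eqVneq (size s) m; first by rewrite ev_val ffunE.
by rewrite ev_out.
Qed.

Lemma ev_sum m I (r : seq I) (F : I -> vec K X m) s :
  ev (\sum_(i <- r) F i) s = \sum_(i <- r) ev (F i) s.
Proof.
elim: r => [|i r IHr]; first by rewrite !big_nil ev0.
by rewrite !big_cons -[F i]scale1r ev_linear scale1r mul1r IHr.
Qed.

Lemma ev_ffun m (F : seq X -> K) s : size s = m ->
  ev ([ffun t : word X m => F (val t)] : vec K X m) s = F s.
Proof. by case/word_of=> w <-; rewrite ev_val ffunE. Qed.

Lemma ev_e m s t : size t = m -> ev (e m s) t = (t == s)%:R.
Proof. by move=> sz; rewrite (ev_ffun (fun t => (t == s)%:R)). Qed.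

Lemma ev_tens m a b (x : vec K X a) (y : vec K X b) s : size s = m ->
  ev (tens m x y) s = ev x (take a s) * ev y (drop a s).
Proof. by move=> sz; rewrite (ev_ffun (fun t => ev x (take a t) * ev y (drop a t))). Qed.

Lemma tens_linearl m a b c (x x' : vec K X a) (y : vec K X b) :
  tens m (c *: x + x') y = c *: tens m x y + tens m x' y.
Proof.
by apply: vec_ext => s sz; rewrite ev_linear !ev_tens // ev_linear mulrDl mulrA.
Qed.

Lemma tens0l m a b (y : vec K X b) : tens m (0 : vec K X a) y = 0.
Proof. by apply: vec_ext => s sz; rewrite ev_tens // !ev0 mul0r. Qed.

Lemma tens0r m a b (x : vec K X a) : tens m x (0 : vec K X b) = 0.
Proof. by apply: vec_ext => s sz; rewrite ev_tens // !ev0 mulr0. Qed.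

Lemma tens_e m a b u v : (a + b = m)%N -> size u = a -> size v = b ->
  tens m (e a u) (e b v) = e m (u ++ v).
Proof.
move=> mE su sv; apply: vec_ext => s sz.
have s1 : size (take a s) = a by rewrite size_takel // sz -mE leq_addr.
have s2 : size (drop a s) = b by rewrite size_drop sz -mE addKn.
rewrite ev_tens // !ev_e // -natrM mulnb -[X in X == u ++ v](cat_take_drop a s).
by rewrite eqseq_cat // s1.
Qed.

Lemma in_span_sub m (G P : vec K X m -> Prop) x :
  subspace P -> (forall g, G g -> P g) -> in_span G x -> P x.
Proof.
move=> sP GP [s [Gs ->]]; rewrite big_seq; apply: subspace_sum => // p /Gs/GP.
exact: subspaceZ.
Qed.

Lemma in_span_gen m (G : vec K X m -> Prop) x : G x -> in_span G x.
Proof.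
move=> Gx; exists [:: (1, x)]; split=> [p|]; first by rewrite inE => /eqP->.
by rewrite big_seq1 scale1r.
Qed.

Lemma in_span_subspace m (G : vec K X m -> Prop) : subspace (in_span G).
Proof.
split; first by exists [::]; split=> //; rewrite big_nil.
move=> a _ _ [s [Gs ->]] [t [Gt ->]].
exists ([seq (a * p.1, p.2) | p <- s] ++ t); split.
  by move=> p; rewrite mem_cat => /orP[/mapP[q /Gs Gq ->]|/Gt].
rewrite big_cat big_map scaler_sumr; congr (_ + _).
by apply: eq_bigr => p _; rewrite scalerA.
Qed.

(** Contraction of [x] with the dual basis words of [u] on the left and [v] on the right. It is zero
    when the lengths do not add up to [m], since [ev] vanishes on words of the wrong length. *)
Definition slice k m (x : vec K X m) u v : vec K X k :=
  [ffun t : word X k => ev x (u ++ val t ++ v)].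

Lemma ev_slice k m (x : vec K X m) u v s : size s = k ->
  ev (slice k x u v) s = ev x (u ++ s ++ v).
Proof. by move=> sz; rewrite (ev_ffun (fun t => ev x (u ++ t ++ v))). Qed.

Lemma slice_linear k m a (x y : vec K X m) u v :
  slice k (a *: x + y) u v = a *: slice k x u v + slice k y u v.
Proof. by apply: vec_ext => s sz; rewrite ev_linear !ev_slice // ev_linear. Qed.

Lemma sliceD k m (x y : vec K X m) u v :
  slice k (x + y) u v = slice k x u v + slice k y u v.
Proof. by have := slice_linear k 1 x y u v; rewrite !scale1r. Qed.

Lemma slice0 k m u v : slice k (0 : vec K X m) u v = 0.
Proof. by apply: vec_ext => s sz; rewrite ev_slice // !ev0. Qed.

Lemma slice_slice k l m (x : vec K X m) u v u' v' : (size u' + k + size v' = l)%N ->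
  slice k (slice l x u v) u' v' = slice k x (u ++ u') (v' ++ v).
Proof.
move=> szl; apply: vec_ext => s sz; rewrite !ev_slice //; last first.
  by rewrite !size_cat sz addnA.
by rewrite -!catA.
Qed.

Lemma slice_id m (x : vec K X m) : slice m x [::] [::] = x.
Proof. by apply: vec_ext => s sz; rewrite ev_slice //= cats0. Qed.

Lemma slice_subspace k m (P : vec K X k -> Prop) u v :
  subspace P -> subspace (fun x : vec K X m => P (slice k x u v)).
Proof.
move=> sP; split=> [|a x y Px Py]; first by rewrite slice0; case: sP.
by rewrite slice_linear; apply: (proj2 sP).
Qed.

(** Expanding [x] along the basis words of the right factor turns a span of pure tensors into a
    coordinatewise condition, which is directly compatible with intersections. *)
Lemma tensS_fullr m a b (P : vec K X a -> Prop) x : (a + b = m)%N -> subspace P ->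
  tensS m a b P (fullS K X b) x <-> forall v, size v = b -> P (slice a x [::] v).
Proof.
move=> mE sP; split=> [tx v sv|Px].
  apply: (in_span_sub (slice_subspace _ [::] v sP) _ tx).
  move=> _ [y [z [Py [_ ->]]]]; suff -> : slice a (tens m y z) [::] v = ev z v *: y.
    exact: subspaceZ.
  apply: vec_ext => s sz; rewrite -[_ *: _]addr0 ev_linear ev0 addr0.
  by rewrite ev_slice // ev_tens ?size_cat ?sz ?sv //= take_size_cat // drop_size_cat // mulrC.
have -> : x = \sum_(v : word X b) tens m (slice a x [::] (val v)) (e b (val v)).
  apply: vec_ext => s sz; have sd : size (drop a s) = b by rewrite size_drop sz -mE addKn.
  have [v vE] := word_of sd.
  rewrite ev_sum (bigD1 v) //= big1 ?addr0 => [|v' nv]; rewrite ev_tens // ev_e //.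
    rewrite ev_slice ?size_takel ?sz -?mE ?leq_addr //=.
    by rewrite vE eqxx mulr1 cat_take_drop.
  by rewrite -vE val_eqE eq_sym (negPf nv) mulr0.
apply: subspace_sum => [|v _]; first exact: in_span_subspace.
apply: in_span_gen; exists (slice a x [::] (val v)), (e b (val v)).
by split; first by apply: Px; rewrite size_tuple.
Qed.

Lemma tensS_fulll m a b (P : vec K X b -> Prop) x : (a + b = m)%N -> subspace P ->
  tensS m a b (fullS K X a) P x <-> forall u, size u = a -> P (slice b x u [::]).
Proof.
move=> mE sP; split=> [tx u su|Px].
  apply: (in_span_sub (slice_subspace _ u [::] sP) _ tx).
  move=> _ [y [z [_ [Pz ->]]]]; suff -> : slice b (tens m y z) u [::] = ev y u *: z.
    exact: subspaceZ.
  apply: vec_ext => s sz; rewrite -[_ *: _]addr0 ev_linear ev0 addr0.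
  by rewrite ev_slice // cats0 ev_tens ?size_cat ?sz ?su //= take_size_cat // drop_size_cat.
have -> : x = \sum_(u : word X a) tens m (e a (val u)) (slice b x (val u) [::]).
  apply: vec_ext => s sz.
  have st : size (take a s) = a by rewrite size_takel ?sz -?mE ?leq_addr.
  have [u uE] := word_of st.
  rewrite ev_sum (bigD1 u) //= big1 ?addr0 => [|u' nu]; rewrite ev_tens // ev_e //.
    rewrite ev_slice ?size_drop ?sz -?mE ?addKn //=.
    by rewrite uE eqxx mul1r cats0 cat_take_drop.
  by rewrite -uE val_eqE eq_sym (negPf nu) mul0r.
apply: subspace_sum => [|u _]; first exact: in_span_subspace.
apply: in_span_gen; exists (e a (val u)), (slice b x (val u) [::]).
by split=> //; split=> //; apply: Px; rewrite size_tuple.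
Qed.

Lemma lead_evP m (x : vec K X m) (w : word X m) :
  lead x w <-> x w != 0 /\ forall s, ev x s != 0 -> s = val w \/ lexlt s (val w).
Proof.
split=> [[nx bx]|[nx bx]]; split=> //.
  move=> s nxs; have [t tE] := word_of (ev_size nxs).
  rewrite -tE ev_val in nxs *; have := bx _ nxs.
  by rewrite ltnS leq_eqVlt rkw_lexlt => /predU1P[/rkw_inj->|]; [left|right].
move=> t nxt; rewrite -ev_val in nxt; rewrite ltnS leq_eqVlt rkw_lexlt.
by case: (bx _ nxt) => [/val_inj->|->]; rewrite ?eqxx ?orbT.
Qed.

Lemma is_lmP m (x : vec K X m) (w : word X m) : is_lm K disp X x w <-> lead x w.
Proof.
split=> [/andP[nx /forallP bx]|/lead_evP[nx bx]].
  apply/lead_evP; split=> // s ns; have [t tE] := word_of (ev_size ns).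
  rewrite -tE ev_val in ns *; have /implyP/(_ ns) := bx t.
  by case/predU1P => [->|->]; [left|right].
rewrite /is_lm nx; apply/forallP => t; apply/implyP; rewrite -ev_val => /bx.
by case=> [/val_inj->|->]; rewrite ?eqxx ?orbT.
Qed.

(** Words with the same prefix [u] and the same suffix [v] compare as their middle parts do. *)
Lemma slice_lead k m (x : vec K X m) (w : word X m) u (s : word X k) v :
  val w = u ++ val s ++ v -> lead x w -> lead (slice k x u v) s.
Proof.
move=> wE /lead_evP[]; rewrite -ev_val => nx bx.
apply/lead_evP; rewrite -ev_val ev_slice ?size_tuple // -wE; split=> // t nt.
have st := ev_size nt; rewrite ev_slice // in nt.
have := bx _ nt; rewrite wE; case.
  by move/eqP; rewrite !eqseq_cat ?st ?size_tuple // => /and3P[_ /eqP-> _]; left.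
rewrite lexlt_cat // lexlt_irr eqxx lexlt_cat ?st ?size_tuple //=.
by rewrite lexlt_irr andbF orbF; right.
Qed.

(** The tensor of the word [u], the vector [h] and the word [v], in coordinates. *)
Definition plug m k u (h : vec K X k) v : vec K X m :=
  [ffun t : word X m => ((take (size u) (val t) == u) && (drop (size u + k) (val t) == v))%:R *
     ev h (take k (drop (size u) (val t)))].

Lemma ev_plug m k u (h : vec K X k) v u' s v' :
  size u' = size u -> size s = k -> size (u' ++ s ++ v') = m ->
  ev (plug m u h v) (u' ++ s ++ v') = ((u' == u) && (v' == v))%:R * ev h s.
Proof.
move=> su ss sm; rewrite (ev_ffun (fun t => ((take (size u) t == u) &&
  (drop (size u + k) t == v))%:R * ev h (take k (drop (size u) t)))) //.
rewrite -su take_size_cat // [drop (size u') _]drop_size_cat // take_size_cat //.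
by rewrite catA drop_size_cat // size_cat ss.
Qed.

Lemma plug_lead m k u (h : vec K X k) v (s : word X k) (w : word X m) :
  val w = u ++ val s ++ v -> lead h s -> lead (plug m u h v) w.
Proof.
move=> wE; have sw : size (u ++ val s ++ v) = m by rewrite -wE size_tuple.
case/lead_evP; rewrite -ev_val => nh bh.
apply/lead_evP; rewrite -ev_val; split.
  by rewrite wE ev_plug // ?size_tuple // !eqxx mul1r.
move=> t nt; have st := ev_size nt.
move: nt; rewrite -(cat_take_drop (size u) t) -(cat_take_drop k (drop (size u) t)).
move: sw; rewrite !size_cat size_tuple => sw.
have s1 : size (take (size u) t) = size u by rewrite size_takel // st -sw leq_addr.
have s2 : size (take k (drop (size u) t)) = k.
  by rewrite size_takel // size_drop st -sw addKn leq_addr.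
rewrite ev_plug //; last by rewrite !cat_take_drop.
have [->|_] := eqVneq (take (size u) t) u; last by rewrite mul0r eqxx.
have [->|_] := eqVneq (drop k (drop (size u) t)) v; last by rewrite mul0r eqxx.
rewrite mul1r wE => /bh[->|lt]; first by left.
by right; rewrite lexlt_cat // lexlt_irr eqxx lexlt_cat ?lt // s2 size_tuple.
Qed.

Lemma slice_plug l k m u (h : vec K X k) v u1 u2 v1 v2 :
  size u1 = size u -> size v1 = size v ->
  (size u + k + size v = m)%N -> (size u2 + l + size v2 = k)%N ->
  slice l (plug m u h v) (u1 ++ u2) (v2 ++ v1) =
  ((u1 == u) && (v1 == v))%:R *: slice l h u2 v2.
Proof.
move=> su sv mE kE; apply: vec_ext => s sz; rewrite -[_ *: _]addr0 ev_linear ev0 addr0.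
rewrite !ev_slice //.
have -> : (u1 ++ u2) ++ s ++ v2 ++ v1 = u1 ++ (u2 ++ s ++ v2) ++ v1 by rewrite -!catA.
by rewrite ev_plug // !size_cat; lia.
Qed.

(** * Occurrences of the relations at a given position *)

Section RelationSlices.
Variables (N : nat) (R : seq (vec K X N)).
Local Notation Rbar := (Rbar K disp X N R).
Local Notation RbarAt := (RbarAt K disp X N R).

(* membership of x in V^i (x) Rbar (x) V^(m-N-i), tested on slices *)
Definition rel_at m i (x : vec K X m) := forall u v,
  size u = i -> (i + N + size v = m)%N -> Rbar (slice N x u v).

Lemma Rbar_subspace : subspace Rbar.
Proof. exact: in_span_subspace. Qed.

Lemma rel_at_subspace m i : subspace (@rel_at m i).
Proof.
split=> [u v _ _|a x y Ax Ay u v su sv].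
  by rewrite slice0; case: Rbar_subspace.
by rewrite slice_linear; apply: (proj2 Rbar_subspace); [apply: Ax|apply: Ay].
Qed.

Lemma RbarAtP m i x : (i + N <= m)%N -> RbarAt m i x <-> rel_at i x.
Proof.
move=> leim; have mE : (i + N + (m - N - i) = m)%N by rewrite -subnDA [(N + i)%N]addnC subnKC.
have sR := Rbar_subspace.
have st : subspace (tensS (i + N) i N (fullS K X i) Rbar) by apply: in_span_subspace.
rewrite /Defs.RbarAt tensS_fullr //; split=> Ax.
  move=> u v su sv; have {}sv : size v = (m - N - i)%N.
    by apply/eqP; rewrite -(eqn_add2l (i + N)) sv mE.
  move/tensS_fulll: (Ax v sv) => /(_ erefl sR u su).
  by rewrite slice_slice ?su ?addn0.
move=> v sv; apply/tensS_fulll => // u su.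
by rewrite slice_slice ?su ?addn0 //=; apply: Ax; rewrite ?sv.
Qed.

Lemma slice_rel_at k m (x : vec K X m) u v i : (size u + k + size v = m)%N ->
  rel_at (size u + i) x -> rel_at i (slice k x u v).
Proof.
move=> km Ax u' v' su' sv'; rewrite slice_slice ?su' //; apply: Ax.
  by rewrite size_cat su'.
by rewrite -km -sv' size_cat !addnA.
Qed.

Lemma plug_rel_at k m u v i (h : vec K X k) : (size u + k + size v = m)%N ->
  (i + N <= k)%N -> rel_at i h -> rel_at (size u + i) (plug m u h v).
Proof.
move=> km lei Ah u' v' su' sv'.
rewrite -(cat_take_drop (size u) u') -(cat_take_drop (size v' - size v) v').
rewrite slice_plug ?size_drop ?size_takel //; try lia.
apply: subspaceZ; first exact: Rbar_subspace.
by apply: Ah; rewrite ?size_drop ?size_takel; lia.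
Qed.

Lemma rel_at_full x : @rel_at N 0 x <-> Rbar x.
Proof.
split=> [Ax|Rx u v /size0nil-> sv]; first by rewrite -(slice_id x); apply: Ax => //; rewrite addn0.
by rewrite (size0nil (s := v)) ?slice_id //; lia.
Qed.

Lemma seq_split s i k : (i + k <= size s)%N ->
  exists u t v, [/\ s = u ++ t ++ v, size u = i & size t = k].
Proof.
move=> leik; exists (take i s), (take k (drop i s)), (drop k (drop i s)).
by rewrite !cat_take_drop; split=> //; rewrite ?size_drop ?size_takel ?size_drop; lia.
Qed.

(** The letters of [w] outside the window are frozen: slicing [f] and [g] along them gives a
    confluence problem of length [k], and the vector found there is plugged back between the same
    letters. *)
Lemma conf_slice k m p i j : (p + k <= m)%N -> (i + N <= k)%N -> (j + N <= k)%N ->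
  conf (@rel_at k i) (@rel_at k j) -> conf (@rel_at m (p + i)) (@rel_at m (p + j)).
Proof.
move=> lem lei lej cij f g w Af Ag ld.
have sw : size (val w) = m by rewrite size_tuple.
have: (p + k <= size (val w))%N by rewrite sw.
case/seq_split=> u [t [v [wE su /word_of[s sE]]]]; subst p t.
have mE : (size u + k + size v = m)%N by rewrite -sw wE !size_cat size_tuple addnA.
have lds := slice_lead wE ld.
rewrite sliceD in lds.
case: (cij _ _ _ (slice_rel_at mE Af) (slice_rel_at mE Ag) lds) => -[h Ah lh].
  by left; exists (plug m u h v); [apply: plug_rel_at|apply: plug_lead lh].
by right; exists (plug m u h v); [apply: plug_rel_at|apply: plug_lead lh].
Qed.

End RelationSlices.
End Slices.

(** * The operator [S], its extensions to longer words, and disjoint occurrences *)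

Section Operators.
Local Open Scope ring_scope.
Set Implicit Arguments.
Unset Strict Implicit.

Variables (K : fieldType) (disp : Order.disp_t) (X : finOrderType disp).
Local Notation lexlt := (@lexlt disp X).
Local Notation e := (e K disp X).
Local Notation ev := (ev K disp X).
Local Notation tens m := (tens K disp X m).
Local Notation lead := (lead (@rkw disp X _)).
Local Notation lms := (lms (@rkw disp X _)).
Local Notation conf := (conf (@rkw disp X _)).
Implicit Types (s t u v : seq X).

Lemma sum_cat m a b (F : seq X -> seq X -> K) : (a + b = m)%N ->
  \sum_(w : word X m) F (take a (val w)) (drop a (val w)) =
  \sum_(u : word X a) \sum_(v : word X b) F (val u) (val v).
Proof.
move=> mE; subst m; rewrite pair_big /=.
have st (w : word X (a + b)) : size (take a (val w)) == a.
  by rewrite size_takel // size_tuple leq_addr.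
have sd (w : word X (a + b)) : size (drop a (val w)) == b.
  by rewrite size_drop size_tuple addKn.
rewrite (reindex (fun p : word X a * word X b => cat_tuple p.1 p.2)).
  apply: eq_bigr => -[u v] _ /=.
  by rewrite take_size_cat ?drop_size_cat ?size_tuple.
exists (fun w => (Tuple (st w), Tuple (sd w))) => [[u v] _|w _].
  by congr (_, _); apply: val_inj; rewrite /= ?take_size_cat ?drop_size_cat ?size_tuple.
by apply: val_inj; rewrite /= cat_take_drop.
Qed.

Lemma app_ev n (T : word X n -> vec K X n) (x : vec K X n) s :
  ev (app T x) s = \sum_(w : word X n) ev x (val w) * ev (T w) s.
Proof.
have [/word_of[w <-]|sz] := eqVneq (size s) n; last first.
  by rewrite ev_out // big1 // => w _; rewrite [ev (T w) s]ev_out ?mulr0.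
by rewrite ev_val app_coef; apply: eq_bigr => t _; rewrite !ev_val.
Qed.

Lemma app_idl_tens a n m (T : word X n -> vec K X n) (x : vec K X a) (y : vec K X n) :
  (a + n = m)%N -> app (idl K disp X a n m T) (tens m x y) = tens m x (app T y).
Proof.
move=> mE; apply: vec_ext => s sz.
have s1 : size (take a s) = a by rewrite size_takel // sz -mE leq_addr.
rewrite app_ev ev_tens //; have [u0 uE] := word_of s1.
pose F u v := ev x u * ev y v * ((u == take a s)%:R * ev (app T (e n v)) (drop a s)).
rewrite (eq_bigr (fun w : word X m => F (take a (val w)) (drop a (val w)))); last first.
  by move=> w _; rewrite /idl !ev_tens ?size_tuple // ev_e // eq_sym.
rewrite (sum_cat F mE) (bigD1 u0) //= [X in _ + X]big1 ?addr0 => [|u nu].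
  rewrite app_ev mulr_sumr; apply: eq_bigr => v _.
  by rewrite /F uE eqxx mul1r app_e mulrA.
rewrite big1 // => v _.
by rewrite /F -uE val_eqE (negPf nu) mul0r mulr0.
Qed.

Lemma app_idr_tens n a m (T : word X n -> vec K X n) (x : vec K X n) (y : vec K X a) :
  (n + a = m)%N -> app (idr K disp X n a m T) (tens m x y) = tens m (app T x) y.
Proof.
move=> mE; apply: vec_ext => s sz.
have s2 : size (drop n s) = a by rewrite size_drop sz -mE addKn.
rewrite app_ev ev_tens //; have [v0 vE] := word_of s2.
pose F u v := ev x u * ev y v * (ev (app T (e n u)) (take n s) * (v == drop n s)%:R).
rewrite (eq_bigr (fun w : word X m => F (take n (val w)) (drop n (val w)))); last first.
  by move=> w _; rewrite /idr !ev_tens ?size_tuple // ev_e // eq_sym.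
rewrite (sum_cat F mE) app_ev mulr_suml; apply: eq_bigr => u _.
rewrite (bigD1 v0) //= big1 ?addr0 => [|v nv].
  by rewrite /F vE eqxx mulr1 app_e mulrAC.
by rewrite /F -vE val_eqE (negPf nv) !mulr0.
Qed.

Lemma triangular_ev n (T : word X n -> vec K X n) : triangular T <->
  forall w, T w = e n (val w) \/ forall s, ev (T w) s != 0 -> lexlt s (val w).
Proof.
split=> tT w; case: (tT w) => [->|bT]; [by left|right|by left|right].
  move=> s ns; have [t tE] := word_of (ev_size ns).
  by rewrite -tE ev_val in ns *; rewrite -rkw_lexlt; apply: bT.
by move=> t nt; rewrite rkw_lexlt; apply: bT; rewrite ev_val.
Qed.

Lemma idl_fixed a n m (T : word X n -> vec K X n) (w : word X m) (s : word X n) :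
  (a + n = m)%N -> val s = drop a (val w) -> T s = e n (val s) ->
  idl K disp X a n m T w = e m (val w).
Proof.
move=> mE sE fs; rewrite /idl -sE app_e fs tens_e ?size_tuple //.
  by rewrite sE cat_take_drop.
lia.
Qed.

Lemma idr_fixed a n m (T : word X n -> vec K X n) (w : word X m) (s : word X n) :
  (n + a = m)%N -> val s = take n (val w) -> T s = e n (val s) ->
  idr K disp X n a m T w = e m (val w).
Proof.
move=> mE sE fs; rewrite /idr -sE app_e fs tens_e ?size_tuple //.
  by rewrite sE cat_take_drop.
lia.
Qed.

Lemma idl_triangular a n m (T : word X n -> vec K X n) : (a + n = m)%N ->
  triangular T -> triangular (idl K disp X a n m T).
Proof.
move=> mE tT; apply/triangular_ev => w.
have : size (drop a (val w)) = n by rewrite size_drop size_tuple -mE addKn.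
case/word_of => s sE; have /triangular_ev/(_ s)[fs|bT] := tT.
  by left; exact: (idl_fixed mE sE fs).
right=> t nt; have st := ev_size nt; move: nt; rewrite /idl ev_tens //.
rewrite -sE app_e ev_e; last by rewrite size_takel // st -mE leq_addr.
have [tE|_] := eqVneq (take a t) (take a (val w)); last by rewrite mul0r eqxx.
rewrite mul1r => /bT lt; rewrite -(cat_take_drop a t) -(cat_take_drop a (val w)) tE -sE.
by rewrite lexlt_cat // lt eqxx orbT.
Qed.

Lemma idr_triangular a n m (T : word X n -> vec K X n) : (n + a = m)%N ->
  triangular T -> triangular (idr K disp X n a m T).
Proof.
move=> mE tT; apply/triangular_ev => w.
have : size (take n (val w)) = n by rewrite size_takel // size_tuple -mE leq_addr.
case/word_of => s sE; have /triangular_ev/(_ s)[fs|bT] := tT.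
  by left; exact: (idr_fixed mE sE fs).
right=> t nt; have st := ev_size nt; move: nt; rewrite /idr ev_tens //.
rewrite -sE app_e ev_e; last by rewrite size_drop st -mE addKn.
have [tE|_] := eqVneq (drop n t) (drop n (val w)); last by rewrite mulr0 eqxx.
rewrite mulr1 => nt; have lt := bT _ nt.
rewrite -(cat_take_drop n t) -(cat_take_drop n (val w)) tE -sE.
by rewrite lexlt_cat ?lt // (ev_size nt) size_tuple.
Qed.

Lemma app_fixed m (T : word X m -> vec K X m) (x : vec K X m) :
  (forall w, x w != 0 -> T w = e m (val w)) -> app T x = x.
Proof.
move=> fx; apply/ffunP => w; rewrite app_coef (bigD1 w) //= big1 ?addr0 => [|t nt].
  have [->|/fx->] := eqVneq (x w) 0; first by rewrite mul0r.
  by rewrite e_coef eqxx mulr1.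
have [->|/fx->] := eqVneq (x t) 0; first by rewrite mul0r.
by rewrite e_coef eq_sym (negPf nt) mulr0.
Qed.

Section Reduction.
Variables (N : nat) (R : seq (vec K X N)).
Hypothesis redR : reduced_presentation R.
Local Notation Rbar := (Rbar K disp X N R).
Local Notation S := (Sop K disp X N R).

(** [Sop] picks the first relation led by [w]; reducedness makes it the only one, as two distinct
    relations cannot have leading words that are factors of each other. *)
Lemma Sop_lm f w : f \in R -> is_lm K disp X f w -> S w = e N (val w) - f.
Proof.
move=> Rf lf; rewrite /Sop; case E : [seq g <- R | _] => [|g r].
  by have := mem_filter (fun g => is_lm K disp X g w) f R; rewrite E Rf lf.
have : g \in [seq g <- R | is_lm K disp X g w] by rewrite E mem_head.
rewrite mem_filter => /andP[lg Rg]; have [->//|ngf] := eqVneq g f.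
case: redR => _ [_ /(_ _ _ _ _ Rf Rg ngf lf lg)].
by rewrite infix_refl.
Qed.

Lemma Sop_normal w : normal_form K disp X N R (val w) -> S w = e N (val w).
Proof.
move=> nw; rewrite /Sop; case E : [seq g <- R | _] => [//|g r].
have : g \in [seq g <- R | is_lm K disp X g w] by rewrite E mem_head.
by rewrite mem_filter => /andP[lg /nw/(_ lg)]; rewrite infix_refl.
Qed.

Lemma Sop_cases w : S w = e N (val w) \/
  exists2 f, f \in R & [/\ lead f w, f w = 1 & S w = e N (val w) - f].
Proof.
have [/hasP[f Rf lf]|/hasPn noR] := boolP (has (fun f => is_lm K disp X f w) R); last first.
  left; rewrite /Sop; case E : [seq g <- R | _] => [//|g r].
  have : g \in [seq g <- R | is_lm K disp X g w] by rewrite E mem_head.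
  by rewrite mem_filter => /andP[lg /noR]; rewrite lg.
right; exists f => //; split; [exact/is_lmP| |exact: Sop_lm].
case: redR => /(_ _ Rf)[w' [lw' <-]] _; congr (f _).
by apply: (lead_uniq (@rkw_inj _ _ _)); apply/is_lmP; eassumption.
Qed.

Lemma Sop_triangular : triangular S.
Proof.
move=> w; case: (Sop_cases w) => [->|[f Rf [[nf bf] fw ->]]]; [by left|right].
apply: (below_cancel (@rkw_inj _ _ _) (w := w)) => //; last first.
  by rewrite !ffunE eqxx fw subrr.
apply: (subspaceB (@below_subspace _ _ _ _)) => // t; rewrite e_coef.
by case: (t =P w) => [->|_]; rewrite ?eqxx.
Qed.

Lemma Sop_lms w : S w <> e N (val w) -> lms Rbar w.
Proof.
case: (Sop_cases w) => // -[f Rf [lf _ _]] _; exists f => //.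
exact: in_span_gen.
Qed.

Lemma Sop_ker x : Rbar x -> app S x = 0.
Proof.
move=> Rx; apply: (in_span_sub (app_ker_subspace _) _ Rx) => f Rf.
case: redR => /(_ _ Rf)[w [lw fw]] [nfR _].
(* The tail of a relation consists of normal words, so [S] fixes it, while it sends [w] to [w - f],
   the opposite of that tail. *)
have fE : app S (f - e N (val w)) = f - e N (val w).
  apply: app_fixed => t nt; apply: Sop_normal.
  have ntw : t != w by apply: contraNneq nt => ->; rewrite !ffunE fw eqxx subrr.
  apply: (nfR _ _ Rf lw _ ntw); apply: contra_neq nt => ft.
  by rewrite !ffunE ft val_eqE (negPf ntw) subr0.
have := app_linear S 1 (f - e N (val w)) (e N (val w)).
by rewrite !scale1r subrK fE app_e (Sop_lm Rf lw) => ->; rewrite addrA subrK subrr.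
Qed.

(** The counterpart of Buchberger's coprime criterion. If [S] moves the factor [s] of [w] at [i],
    then [w] already leads an element of E_i; otherwise the contraction exhibits the factor at [j]
    as a leading word of [Rbar]. *)
Lemma conf_disjoint m i j : (i + N <= j)%N -> (j + N <= m)%N ->
  conf (@rel_at K disp X N R m i) (@rel_at K disp X N R m j).
Proof.
move=> leij lejm f g w Af Ag ld.
have sw : size (val w) = m by rewrite size_tuple.
have: (i + N <= size (val w))%N by rewrite sw; lia.
case/seq_split=> u [s0 [v0 [wE su /word_of[s sE]]]]; subst i s0.
have m0E : (size u + N + size v0 = m)%N by rewrite -sw wE !size_cat size_tuple addnA.
have [fs|/eqP/Sop_lms[h Rh lh]] := eqVneq (S s) (e N (val s)); last first.
  left; exists (plug m u h v0); last exact: plug_lead lh.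
  rewrite -[size u]addn0; apply: plug_rel_at => //; exact/rel_at_full.
have: (j - (size u + N) + N <= size v0)%N by lia.
case/seq_split=> v [t0 [z [v0E sv /word_of[t tE]]]]; subst t0 v0.
have m1E : (j + N + size z = m)%N.
  by rewrite !size_cat size_tuple in m0E; lia.
have u1E : size (u ++ val s ++ v) = j by rewrite !size_cat size_tuple; lia.
have w1E : val w = (u ++ val s ++ v) ++ val t ++ z by rewrite wE -!catA.
(* c contracts the letters i to i+N-1 against the coordinate of S at s; it
   kills f and maps g into Rbar *)
pose c (x : vec K X m) : vec K X N :=
  [ffun r : word X N => app S (slice N x u (v ++ val r ++ z)) s].
have size_tail (r : word X N) : size (v ++ val r ++ z) = size (v ++ val t ++ z).
  by rewrite !size_cat !size_tuple.
have cD x y : c (x + y) = c x + c y.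
  apply/ffunP => r; rewrite !ffunE sliceD.
  by have := app_linear S 1 (slice N x u (v ++ val r ++ z)) (slice N y u (v ++ val r ++ z));
    rewrite !scale1r => ->; rewrite ffunE.
have cf : c f = 0.
  apply/ffunP => r; rewrite !ffunE Sop_ker ?ffunE //; apply: Af => //.
  by rewrite size_tail.
have cg : Rbar (c g).
  have -> : c g = \sum_(r : word X N) (S r s : K) *: slice N g (u ++ val r ++ v) z.
    apply/ffunP => r; rewrite sum_ffunE ffunE app_coef; apply: eq_bigr => r' _.
    by rewrite !ffunE mulrC -!catA.
  apply: subspace_sum => [|r _]; first exact: Rbar_subspace.
  apply: subspaceZ; first exact: Rbar_subspace.
  by apply: Ag => //; rewrite -u1E !size_cat !size_tuple.
(* On [f + g] the contraction is a plain slice: [S] fixes [s], and a word above [s] in the window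
   would give a word above [w] in [f + g], whatever the tail. *)
have cfg : c (f + g) = slice N (f + g) (u ++ val s ++ v) z.
  apply/ffunP => r; rewrite ffunE (triangular_coef Sop_triangular) ?fs ?eqxx //.
  - by rewrite !ffunE -!catA.
  move=> r' lt; rewrite ffunE => nz; case/lead_evP: ld => _ /(_ _ nz).
  rewrite rkw_lexlt in lt; rewrite wE => -[/eqP|].
    rewrite eqseq_cat // eqseq_cat ?size_tuple // => /and3P[_ /eqP/val_inj rs _].
    by rewrite rs lexlt_irr in lt.
  rewrite lexlt_cat // lexlt_irr eqxx lexlt_cat ?size_tuple //=.
  case/orP => [gt|/andP[/eqP/val_inj rs _]]; last by rewrite rs lexlt_irr in lt.
  by have := lexlt_trans lt gt; rewrite lexlt_irr.
right; exists (plug m (u ++ val s ++ v) (c g) z).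
  rewrite -u1E -[size (u ++ _)]addn0; apply: plug_rel_at => //; first by rewrite u1E.
  exact/rel_at_full.
apply: (plug_lead w1E); rewrite -[c g]add0r -cf -cD cfg.
exact: (slice_lead w1E ld).
Qed.

End Reduction.
End Operators.

(** * Pairwise confluence of all positions; the kernels as sums and intersections *)

Section Koszul.
Local Open Scope ring_scope.
Set Implicit Arguments.
Unset Strict Implicit.

Variables (K : fieldType) (disp : Order.disp_t) (X : finOrderType disp).
Variables (N : nat) (R : seq (vec K X N)).
Local Notation Rbar := (Rbar K disp X N R).
Local Notation S := (Sop K disp X N R).
Local Notation rel_at := (rel_at R).
Local Notation conf := (conf (@rkw disp X _)).

Section Confluence.
Hypothesis redR : reduced_presentation R.
Hypothesis sideR : side_confluent R.

(** Side-confluence read on kernels: both occurrences of [Rbar] are killed by the corresponding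
    extension of [S], and a word moved by such an extension contains at that place the leading word
    of a relation, which is plugged in. *)
Lemma conf_overlap d : (1 <= d <= N - 1)%N ->
  conf (@rel_at (d + N)%N d) (@rel_at (d + N)%N 0).
Proof.
move=> dN; have [k [k_gt0 eqk]] := sideR dN.
have tS := Sop_triangular redR; have sR := Rbar_subspace R.
have Nd := addnC N d.
apply: (conf_of_braid (idl_triangular (erefl _) tS) (idr_triangular Nd tS) _ _ _ _ k_gt0 eqk).
- move=> x Ax; have /(in_span_sub (app_ker_subspace _)) :
      tensS (d + N)%N d N (fullS K X d) Rbar x.
    by apply/tensS_fulll => // u su; apply: Ax => //; rewrite addn0.
  by apply=> _ [y [z [_ [Rz ->]]]]; rewrite app_idl_tens // (Sop_ker redR Rz) tens0r.
- move=> x Ax; have /(in_span_sub (app_ker_subspace _)) :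
      tensS (d + N)%N N d Rbar (fullS K X d) x.
    by apply/tensS_fullr => // v sv; apply: Ax => //; rewrite sv add0n.
  by apply=> _ [y [z [Ry [_ ->]]]]; rewrite app_idr_tens // (Sop_ker redR Ry) tens0l.
- move=> w nw; have sw : size (val w) = (d + N)%N by rewrite size_tuple.
  have sd : size (drop d (val w)) = N by rewrite size_drop sw addKn.
  have st : size (take d (val w)) = d by rewrite size_takel // sw leq_addr.
  have [s sE] := word_of sd.
  have [|h Rh lh] := @Sop_lms _ _ _ _ _ redR s.
    by move/(idl_fixed (erefl _) sE).
  exists (plug (d + N)%N (take d (val w)) h [::]).
    rewrite -[d in rel_at d]addn0 -{2}st; apply: plug_rel_at => //.
      by rewrite st addn0.
    exact/rel_at_full.
  by apply: plug_lead lh; rewrite cats0 sE cat_take_drop.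
- move=> w nw; have sw : size (val w) = (d + N)%N by rewrite size_tuple.
  have st : size (take N (val w)) = N by rewrite size_takel // sw leq_addl.
  have [s sE] := word_of st.
  have [|h Rh lh] := @Sop_lms _ _ _ _ _ redR s.
    by move/(idr_fixed Nd sE).
  exists (plug (d + N)%N [::] h (drop N (val w))).
    apply: (@plug_rel_at _ _ _ _ _ N _ [::] _ 0) => //; last exact/rel_at_full.
    by rewrite size_drop sw addnK addnC.
  by apply: plug_lead lh; rewrite sE /= cat_take_drop.
Qed.

Lemma conf_rel_at m i j : (i + N <= m)%N -> (j + N <= m)%N ->
  conf (@rel_at m i) (@rel_at m j).
Proof.
wlog leij : i j / (i <= j)%N.
  by move=> wl lei lej; case/orP: (leq_total i j) => /wl; [|move/(_ lej lei)/conf_sym]; apply.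
move=> lei lej; have [<-|nij] := eqVneq i j.
  exact/conf_refl/rel_at_subspace.
have [lt|ge] := ltnP j (i + N); last exact: conf_disjoint.
(* The two occurrences cover a window of length [j - i + N] starting at [i]. *)
have -> : j = (i + (j - i))%N by lia.
rewrite -{1}[i]addn0; apply: (@conf_slice _ _ _ _ _ (j - i + N)); try lia.
apply/conf_sym/conf_overlap; lia.
Qed.

End Confluence.

Lemma IR_subspace a : subspace (IR R a).
Proof. by rewrite /IR; case: ifP => _; [apply: subspace0|apply: in_span_subspace]. Qed.

Lemma tens_rel_at m a b i (x : vec K X a) (y : vec K X b) : (a + b = m)%N ->
  (i + N <= a)%N -> rel_at i x -> rel_at i (tens K disp X m x y).
Proof.
move=> mE lei Ax u v su sv.
have stv : size (take (a - i - N) v) = (a - i - N)%N by rewrite size_takel //; lia.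
have -> : slice N (tens K disp X m x y) u v =
    ev K disp X y (drop (a - i - N) v) *: slice N x u (take (a - i - N) v).
  apply: vec_ext => s sz; rewrite -[_ *: _]addr0 ev_linear ev0 addr0.
  rewrite !ev_slice // -{1}(cat_take_drop (a - i - N) v).
  rewrite ev_tens; last by rewrite !size_cat sz stv size_drop; lia.
  have -> : u ++ s ++ take (a - i - N) v ++ drop (a - i - N) v =
    (u ++ s ++ take (a - i - N) v) ++ drop (a - i - N) v by rewrite -!catA.
  have sa : size (u ++ s ++ take (a - i - N) v) = a by rewrite !size_cat sz stv; lia.
  by rewrite take_size_cat // drop_size_cat // mulrC.
apply: subspaceZ; first exact: Rbar_subspace.
by apply: Ax => //; rewrite stv; lia.
Qed.

(** [a.+1 - N] counts the positions i with i + N at most [a]. Truncation makes it 0 for [a < N],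
    where the empty sum matches the zero component of I(R). *)
Lemma IR_sumE m a b x : (a + b = m)%N ->
  tensS m a b (IR R a) (fullS K X b) x <-> sumE (@rel_at m) (iota 0 (a.+1 - N)) x.
Proof.
move=> mE; have sA i : subspace (@rel_at m i) by apply: rel_at_subspace.
have sS : subspace (sumE (@rel_at m) (iota 0 (a.+1 - N))) by apply: subspace_sumE.
split=> [tx|].
  apply: (in_span_sub sS _ tx) => _ [y [z [Iy [_ ->]]]].
  have sT : subspace (fun y : vec K X a =>
      sumE (@rel_at m) (iota 0 (a.+1 - N)) (tens K disp X m y z)).
    split=> [|c y1 y2 S1 S2]; first by rewrite tens0l; case: sS.
    by rewrite tens_linearl; apply: (proj2 sS).
  move: Iy; rewrite /IR; case: ltnP => [_ ->|leNa Iy]; first by case: sT.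
  apply: (in_span_sub sT _ Iy) => g [i [lei Ag]].
  have {}lei : (i + N <= a)%N by lia.
  have {}Ag := proj1 (RbarAtP R g lei) Ag.
  apply: (sub_sumE (i := i)) => //; first by rewrite mem_iota; lia.
  exact: tens_rel_at.
apply: sumE_sub => [|i y]; first exact: in_span_subspace.
rewrite mem_iota => lei Ay; apply/tensS_fullr => // [|v sv]; first exact: IR_subspace.
rewrite /IR; case: ltnP => [|leNa]; first by lia.
apply: in_span_gen; exists i; split; first by lia.
apply/RbarAtP; first by lia.
by apply: (@slice_rel_at _ _ _ _ _ a m y [::] v i) => //; rewrite /= sv.
Qed.

(** One description for the three clauses of [J]: no position fits when the length is 1, since [N]
    is at least 2; only position 0 fits in length [N]; from [J] 3 on the length is at least [N], so
    the truncated bound is exact. *)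
Lemma J_rel_at n x : (2 <= N)%N ->
  J R n.+1 (lN N n.+1) x <-> forall i, (i + N <= lN N n.+1)%N -> rel_at i x.
Proof.
move=> N2; case: n x => [|[|n]] x.
- by split=> // _ i; rewrite /lN /=; lia.
- have lE : lN N 2 = N by rewrite /lN /= mul1n.
  move: x; rewrite lE => x; split=> [[y [Ry xy]] i|Ax].
    rewrite -{2}[N]add0n leq_add2r leqn0 => /eqP->.
    have -> : x = y by apply: vec_ext => s _; apply: xy.
    exact/rel_at_full.
  by exists x; split=> //; apply/rel_at_full/Ax.
- have leN : (N <= lN N n.+3)%N.
    have leN : (N <= n.+3./2 * N)%N by rewrite leq_pmull.
    by rewrite /lN; case: ifP => _ //; rewrite (leq_trans leN) // leq_addr.
  split=> Ax i lei; first by apply/RbarAtP => //; apply: Ax; lia.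
  by apply/RbarAtP; [lia|apply: Ax; lia].
Qed.

(** The [b] free letters on the left shift all positions by [b]. For [n = 0] the list is empty and
    the intersection is the whole space. *)
Lemma J_capE m b n x : (2 <= N)%N -> (b + lN N n.+1 = m)%N ->
  tensS m b (lN N n.+1) (fullS K X b) (J R n.+1 (lN N n.+1)) x <->
  capE (@rel_at m) (iota b ((lN N n.+1).+1 - N)) x.
Proof.
move=> N2 mE; set l := lN N n.+1 in mE *.
have sJ : subspace (J R n.+1 l).
  split=> [|c y z]; first by apply/J_rel_at => // i _; case: (rel_at_subspace R l i).
  move=> /(J_rel_at _ N2) Jy /(J_rel_at _ N2) Jz; apply/J_rel_at => // i lei.
  by apply: (proj2 (rel_at_subspace R l i)); [apply: Jy|apply: Jz].
split=> [/(proj1 (tensS_fulll _ mE sJ)) Jx i|Cx].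
  rewrite mem_iota => lei u v su sv.
  have su1 : size (take b u) = b by rewrite size_takel; lia.
  have Ju := proj1 (J_rel_at _ N2) (Jx _ su1).
  have := Ju (i - b)%N _ (drop b u) v _ _; rewrite slice_slice ?cat_take_drop ?cats0.
    by apply; rewrite ?size_drop; lia.
  by rewrite size_drop; lia.
apply/tensS_fulll => // u su; apply/J_rel_at => // i lei.
apply: slice_rel_at; first by rewrite su addn0.
by apply: Cx; rewrite mem_iota su; lia.
Qed.

End Koszul.

Theorem theorem4p1p4 (K : fieldType) (disp : Order.disp_t) (X : finOrderType disp)
  (N : nat) (R : seq (vec K X N)) :
  (2 <= N)%N ->
  reduced_presentation R ->
  side_confluent R ->
  forall n m : nat, (lN N n <= m)%N ->
  forall F1 F2 : word X m -> vec K X m,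
    (* F1 = theta^{-1}(I(R)_{m - l_N(n)} (x) V^{(x) l_N(n)}) *)
    is_redop F1 ->
    ker_is F1 (tensS m (m - lN N n) (lN N n) (IR R (m - lN N n)) (fullS K X (lN N n))) ->
    (* F2 = id if m < l_N(n+1), else theta^{-1}(V^{(x) m - l_N(n+1)} (x) J_{n+1}) *)
    ((m < lN N n.+1)%N -> F2 =1 idop m) ->
    ((lN N n.+1 <= m)%N -> is_redop F2 /\
       ker_is F2 (tensS m (m - lN N n.+1) (lN N n.+1) (fullS K X (m - lN N n.+1))
                    (J R n.+1 (lN N n.+1)))) ->
    exists k : nat, (0 < k)%N /\ braid (app F1) (app F2) k =1 braid (app F2) (app F1) k.
Proof.
move=> N2 redR sideR n m len F1 F2 rF1 kF1 idF2 rkF2.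
have sU1 : subspace (tensS m (m - lN N n) (lN N n) (IR R (m - lN N n)) (fullS K X (lN N n))).
  exact: in_span_subspace.
have [lt|le] := ltnP m (lN N n.+1).
  have app_id x : app F2 x = x by apply: app_fixed => w _; rewrite idF2.
  have rF2 : is_redop F2 by split=> w; [rewrite app_id|left; rewrite idF2].
  have kF2 : ker_is F2 (fun x => x = 0%R) by move=> x; rewrite app_id.
  apply: (braid_of_conf rF1 rF2 kF1 kF2 sU1); [exact: subspace0|exact: conf_zero].
have [rF2 kF2] := rkF2 le.
apply: (braid_of_conf rF1 rF2 kF1 kF2 sU1); first exact: in_span_subspace.
apply: (@conf_ext _ _ _ (sumE (@rel_at _ _ _ _ R m) (iota 0 ((m - lN N n).+1 - N))) _
    (capE (@rel_at _ _ _ _ R m) (iota (m - lN N n.+1) ((lN N n.+1).+1 - N)))).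
- by move=> x; split=> /(IR_sumE R x (subnK len)).
- by move=> x; split=> /(J_capE R x N2 (subnK le)).
(* The common family consists of all positions that fit in length [m]; both lists of positions lie
   in it. *)
apply: (@conf_sumE_capE _ _ _ (@rkw_inj _ _ _) _ _ [pred i | i + N <= m]).
- by move=> i _; apply: rel_at_subspace.
- by move=> i j; rewrite !inE; apply: conf_rel_at.
- by move=> i; rewrite mem_iota inE; lia.
- by move=> i; rewrite mem_iota inE; lia.
Qed.
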